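(* Let $R_1$ and $R_2$ be two finite non-commutative rings, and let $(\alpha,\beta)$ be a $\mathbb{Z}$-isoclinism between $R_1$ and $R_2$. Then for every $r\in [R_1,R_1]$, $$\mathrm{Pr}_r(R_1) = \mathrm{Pr}_{\beta(r)}(R_2).$$
   Context: For a ring $R$ and $x,y\in R$, the commutator is $[x,y] := xy-yx$. For a finite ring $R$ and $r\in R$, $\mathrm{Pr}_r(R) := \frac{|\{(x,y)\in R\times R : [x,y]=r\}|}{|R\times R|}$. $Z(R) := \{z \in R : zy = yz \text{ for all } y\in R\}$ is the center of $R$, and $R/Z(R)$ is the quotient of additive groups. $[R,R]$ denotes the additive subgroup of $(R,+)$ generated by $\{[x,y] : (x,y)\in R\times R\}$. A $\mathbb{Z}$-isoclinism between rings $R_1$ and $R_2$ is a pair $(\alpha,\beta)$ of additive group isomorphisms $\alpha : R_1/Z(R_1)\to R_2/Z(R_2)$ and $\beta : [R_1,R_1]\to [R_2,R_2]$ such that, for all $x_1, y_1 \in R_1$ and $x_2,y_2\in R_2$, $\beta([x_1,y_1]) = [x_2,y_2]$ whenever $\alpha(x_1+Z(R_1)) = x_2+Z(R_2)$ and $\alpha(y_1+Z(R_1)) = y_2+Z(R_2)$. *)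

(* Defs.v *)
From HB Require Import structures.
From mathcomp Require Import all_boot all_order all_algebra all_fingroup.

Set Implicit Arguments.
Unset Strict Implicit.
Unset Printing Implicit Defensive.

Import GRing.Theory.
Local Open Scope ring_scope.

(* Associative rings that need not have a multiplicative identity: MathComp's
   own hierarchy of rings starts with unital ones. *)
HB.mixin Record Zmodule_isRng R of GRing.Zmodule R := {
  rng_mul : R -> R -> R;
  rng_mulA : associative rng_mul;
  rng_mulDl : left_distributive rng_mul +%R;
  rng_mulDr : right_distributive rng_mul +%R
}.

#[short(type="finRngType")]
HB.structure Definition FinRng := {R of Zmodule_isRng R & FinRing.Zmodule R}.

(* The finite group of a finite ring is its additive group, as in finalg: in
   the scope %g, x * y is x + y, 1 is 0, and R / H is the additive quotient. *)
#[non_forgetful_inheritance]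
HB.instance Definition _ (R : finRngType) := [finGroupMixin of R for +%R].
Coercion finRng_to_baseFinGroup (R : finRngType) := FinStarMonoid.clone R _.
Coercion finRng_to_finGroup (R : finRngType) := FinGroup.clone R _.

Local Infix "**" := rng_mul (at level 40, left associativity).

Section FiniteRings.

Variable R : finRngType.
Implicit Types x y z r : R.

Definition rng_comm x y : R := x ** y - y ** x.

Definition rng_center : {set R} := [set z | [forall y, z ** y == y ** z]].

Lemma rng_center_group_set : group_set rng_center.
Proof.
have mul0x y : 0 ** y = 0.
  by apply: (addrI (0 ** y)); rewrite -rng_mulDl !addr0.
have mulx0 y : y ** 0 = 0.
  by apply: (addrI (y ** 0)); rewrite -rng_mulDr !addr0.
apply/group_setP; split.
  by rewrite inE; apply/forallP => y; rewrite mul0x mulx0.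
move=> x z; rewrite !inE => /forallP cx /forallP cz; apply/forallP => y.
by rewrite rng_mulDl rng_mulDr (eqP (cx y)) (eqP (cz y)).
Qed.
Canonical rng_center_group := Group rng_center_group_set.

Definition rng_comm_subgroup : {group R} :=
  <<[set rng_comm p.1 p.2 | p in [set: R * R]]>>%G.

Definition Pr r : rat :=
  #|[set p : R * R | rng_comm p.1 p.2 == r]|%:R / #|[set: R * R]|%:R.

(* As the additive group is abelian, the domain 'N(rng_center) of the
   projection coset rng_center is all of R, so that coset rng_center x
   is x + Z(R) for every x. *)
Lemma val_coset_rng_center x :
  coset rng_center x = [set x + z | z in rng_center] :> {set R}.
Proof.
have nZx : x \in 'N(rng_center)%g.
  have cRR : abelian [set: R].
    by apply/centsP => u _ v _; apply: addrC.
  exact: (subsetP (sub_abelian_norm cRR (subsetT _))).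
rewrite val_coset // norm_rlcoset //.
apply/setP => u; apply/lcosetP/imsetP => -[z zZ ->]; by exists z.
Qed.

End FiniteRings.

Arguments rng_center R : clear implicits.
Arguments rng_comm_subgroup R : clear implicits.

Definition Z_isoclinism (R1 R2 : finRngType)
    (alpha : {morphism ([set: R1] / rng_center R1)%g >->
               coset_of (rng_center R2)})
    (beta : {morphism rng_comm_subgroup R1 >-> R2}) : Prop :=
  [/\ isom ([set: R1] / rng_center R1)%g ([set: R2] / rng_center R2)%g alpha,
      isom (rng_comm_subgroup R1) (rng_comm_subgroup R2) beta
    & forall (x1 y1 : R1) (x2 y2 : R2),
        alpha (coset (rng_center R1) x1) = coset (rng_center R2) x2 ->
        alpha (coset (rng_center R1) y1) = coset (rng_center R2) y2 ->
        beta (rng_comm x1 y1) = rng_comm x2 y2].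

(* Main.v *)
(* Let x ~ y mean that alpha (x + Z(R1)) = y + Z(R2). Every x is related to
   |Z(R2)| elements y and every y to |Z(R1)| elements x, and related pairs have
   commutators corresponding under the injection beta. Counting related pairs
   of pairs in two ways, with and without the condition [x, y] = r, gives
   N1(r) |Z(R2)|^2 = N2(beta r) |Z(R1)|^2 and |R1|^2 |Z(R2)|^2 = |R2|^2 |Z(R1)|^2,
   where Ni(s) is the number of pairs in Ri with commutator s. *)
Require Import Defs.
From mathcomp Require Import all_boot all_order all_algebra all_fingroup.

Set Implicit Arguments.
Unset Strict Implicit.
Unset Printing Implicit Defensive.

(** Double counting: by the compatibility of [e] with [P] and [Q], an edge with one end in [P] or
    [Q] has its other end in the other set, so both products count the edges between [P] and [Q]. *)
Lemma card_biregular (A B : finType) (e : A -> B -> bool) (k l : nat)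
    (P : {set A}) (Q : {set B}) :
    (forall a, #|[set b | e a b]| = k) -> (forall b, #|[set a | e a b]| = l) ->
    (forall a b, e a b -> (a \in P) = (b \in Q)) ->
  (#|P| * k = #|Q| * l)%N.
Proof.
move=> degA degB ePQ.
rewrite -!sum_nat_const.
transitivity (\sum_(a in P) \sum_(b in Q) e a b)%N.
  apply: eq_bigr => a aP; rewrite -(degA a) -sum1dep_card big_mkcond.
  rewrite [RHS]big_mkcond; apply: eq_bigr => b _.
  by case: ifP => [/ePQ <-|]; rewrite ?aP //; case: ifP.
rewrite exchange_big; apply: eq_bigr => b bQ.
rewrite -(degB b) -sum1dep_card big_mkcond [RHS]big_mkcond.
apply: eq_bigr => a _.
by case: (boolP (e a b)) => [/ePQ ->|]; rewrite ?bQ //; case: ifP.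
Qed.

(** The fiber is the right coset of [H] through [x]. Normality matters, since [coset H] takes a
    trivial default value outside ['N(H)]. *)
Lemma card_coset_fiber (gT : finGroupType) (H : {group gT}) (x : gT) :
  ([set: gT] \subset 'N(H))%g ->
  #|[set y | coset H y == coset H x]| = #|H|.
Proof.
move=> nH; have N y : y \in 'N(H)%g by apply: (subsetP nH).
rewrite -(card_rcoset H x); apply: eq_card => y; rewrite inE.
by apply/eqP/idP => /(rcoset_kercosetP (N y) (N x)).
Qed.

Lemma rng_center_norm (R : finRngType) : ([set: R] \subset 'N(rng_center R))%g.
Proof.
apply: sub_abelian_norm (subsetT _).
by apply/centsP => u _ v _; apply: GRing.addrC.
Qed.

Lemma mem_quotient_rng_center (R : finRngType) (x : R) :
  coset (rng_center R) x \in ([set: R] / rng_center R)%g.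
Proof. by rewrite mem_quotient ?inE. Qed.

Lemma rng_comm_in_subgroup (R : finRngType) (x y : R) :
  rng_comm x y \in rng_comm_subgroup R.
Proof. by apply: mem_gen; apply/imsetP; exists (x, y). Qed.

Section Isoclinism.

Variables R1 R2 : finRngType.
Variable alpha :
  {morphism ([set: R1] / rng_center R1)%g >-> coset_of (rng_center R2)}.
Variable beta : {morphism rng_comm_subgroup R1 >-> R2}.
Hypothesis iso : Z_isoclinism alpha beta.

Definition isoclinic_rel (x : R1) (y : R2) :=
  alpha (coset (rng_center R1) x) == coset (rng_center R2) y.

Lemma card_isoclinic_relr (x : R1) :
  #|[set y | isoclinic_rel x y]| = #|rng_center R2|.
Proof.
case: iso => /isomP [_ im_alpha] _ _.
have /morphimP[y0 _ _ eq_y0] :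
    alpha (coset (rng_center R1) x) \in ([set: R2] / rng_center R2)%g.
  by rewrite -im_alpha mem_morphim ?mem_quotient_rng_center.
rewrite -(card_coset_fiber y0 (rng_center_norm R2)).
by apply: eq_card => y; rewrite !inE /isoclinic_rel eq_y0 eq_sym.
Qed.

(** Surjectivity of [alpha] provides one related [x0]; injectivity then shows that the related
    elements are exactly those of [x0 + Z(R1)]. *)
Lemma card_isoclinic_rell (y : R2) :
  #|[set x | isoclinic_rel x y]| = #|rng_center R1|.
Proof.
case: iso => /isomP [/injmP inj_alpha im_alpha] _ _.
have := mem_quotient_rng_center y; rewrite -im_alpha.
case/morphimP => c _ /morphimP[x0 _ _ ->] eq_y.
rewrite -(card_coset_fiber x0 (rng_center_norm R1)).
apply: eq_card => x; rewrite !inE /isoclinic_rel eq_y.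
by rewrite (inj_in_eq inj_alpha) ?mem_quotient_rng_center.
Qed.

Lemma card_isoclinic (P : {set R1 * R1}) (Q : {set R2 * R2}) :
    (forall p q, isoclinic_rel p.1 q.1 -> isoclinic_rel p.2 q.2 ->
       (p \in P) = (q \in Q)) ->
  (#|P| * (#|rng_center R2| * #|rng_center R2|)
     = #|Q| * (#|rng_center R1| * #|rng_center R1|))%N.
Proof.
move=> PQ; apply: (@card_biregular _ _
  (fun p q => isoclinic_rel p.1 q.1 && isoclinic_rel p.2 q.2)).
(* The neighbours of a pair form the product of the neighbour sets of its components, so each factor
   is rewritten with its own component. *)
- move=> p; rewrite -{1}(card_isoclinic_relr p.1) -(card_isoclinic_relr p.2).
  by rewrite -cardsX; apply: eq_card => q; rewrite !inE.
- move=> q; rewrite -{1}(card_isoclinic_rell q.1) -(card_isoclinic_rell q.2).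
  by rewrite -cardsX; apply: eq_card => p; rewrite !inE.
- by move=> p q /andP[]; apply: PQ.
Qed.

End Isoclinism.

Theorem theorem3p1 (R1 R2 : finRngType)
  (nc1 : ~ commutative (@rng_mul R1)) (nc2 : ~ commutative (@rng_mul R2))
  (alpha : {morphism ([set: R1] / rng_center R1)%g >-> coset_of (rng_center R2)})
  (beta : {morphism (rng_comm_subgroup R1) >-> R2})
  (iso : Z_isoclinism alpha beta)
  (r : R1) (hr : r \in rng_comm_subgroup R1) :
  Pr r = Pr (beta r).
Proof.
have card_all := card_isoclinic iso (P := setT) (Q := setT)
  (fun p q _ _ => etrans (in_setT p) (esym (in_setT q))).
have card_comm : (#|[set p | rng_comm p.1 p.2 == r]|
      * (#|rng_center R2| * #|rng_center R2|)
    = #|[set q | rng_comm q.1 q.2 == beta r]|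
      * (#|rng_center R1| * #|rng_center R1|))%N.
  apply: (card_isoclinic iso) => p q /eqP rel1 /eqP rel2; rewrite !inE.
  case: iso => _ /isomP[/injmP inj_beta _] /(_ _ _ _ _ rel1 rel2) <-.
  (* Injectivity of [beta] holds only on the commutator subgroup; [hr] puts [r] there. *)
  by rewrite (inj_in_eq inj_beta) ?rng_comm_in_subgroup.
have center_neq0 (R : finRngType) :
    ((#|rng_center R| * #|rng_center R|)%:R != 0 :> rat)%R.
  by rewrite Num.Theory.pnatr_eq0 -lt0n muln_gt0 cardG_gt0.
have pairs_neq0 (R : finRngType) : (#|[set: R * R]|%:R != 0 :> rat)%R.
  by rewrite Num.Theory.pnatr_eq0 -lt0n; apply/card_gt0P; exists (0, 0)%R.
rewrite /Pr; apply/eqP; rewrite GRing.eqr_div //; apply/eqP.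
(* Multiplying the cross-multiplied equation by both squared center orders makes the two counting
   identities applicable. *)
apply: (GRing.mulIf (GRing.mulf_neq0 (center_neq0 R2) (center_neq0 R1))).
rewrite -!GRing.natrM; congr (_%:R)%R.
by rewrite mulnACA card_comm -card_all mulnACA [X in (_ * X)%N]mulnC.
Qed.
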